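(* Let $3\le k\le n$. (i) In the $(\mathbf x,\mathbf y)$-coordinates on $\mathcal P^0_{k,n}$, the maps $F_k$ and $G_k$ coincide with $T_k$ and $T_k^{-1}$ up to a shift of indices. More exactly, $$F_k=T_k\circ S_{r'+1},\qquad G_k=T_k^{-1}\circ S_{r+1},$$ where $S_t$ is the shift by $t$ in the positive direction. (ii) In the $(\mathbf x,\mathbf y)$-coordinates, the projective duality $\Delta_k$ coincides with $D_k$ up to a sign and a shift of indices. More exactly, $$\Delta_k=(-1)^kD_k\circ S_{r'}.$$
   Context: A twisted $n$-gon in $\mathbf{RP}^{k-1}$ is a sequence $V=(V_i)_{i\in\mathbf Z}$ with $V_{i+n}=M(V_i)$ for all $i$ and a fixed projective transformation $M$ (the monodromy). It is generic if every $k$ consecutive vertices do not lie in a proper projective subspace. $\mathcal P_{k,n}$ is the space of projective equivalence classes of generic twisted $n$-gons. $V$ is corrugated if for every $i$ the points $V_i,V_{i+1},V_{i+k-1},V_{i+k}$ span a projective plane. $\mathcal P^0_{k,n}\subset\mathcal P_{k,n}$ consists of classes of corrugated polygons such that for every $i$ no three of $V_i,V_{i+1},V_{i+k-1},V_{i+k}$ are collinear. Maps (rational, defined on open sets): $F_k(V)$ has $i$th vertex $(V_i,V_{i+k-1})\cap(V_{i+1},V_{i+k})$; $G_k(V)$ has $i$th vertex $(V_i,V_{i+1})\cap(V_{i+k-1},V_{i+k})$; the projectively dual polygon $\Delta_k(V)=W$ in $(\mathbf{RP}^{k-1})^*$ has $W_i$ equal to the hyperplane spanned by $V_i,\dots,V_{i+k-2}$.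 All of these are again (classes of) corrugated twisted polygons, to which the coordinates below apply. Coordinates: a generic corrugated polygon has a lift $\widetilde V_i\in\mathbf R^k\setminus 0$ of its vertices with $$\widetilde V_{i+k}=y_{i-1}\widetilde V_i+x_i\widetilde V_{i+1}+\widetilde V_{i+k-1}\quad\text{for all }i,$$ where $(x_i),(y_i)$ are $n$-periodic sequences uniquely determined by the projective class of $V$, and they determine this class. $\mathbf x=(x_1,\dots,x_n)$, $\mathbf y=(y_1,\dots,y_n)$. Put $r=\lfloor k/2\rfloor-1$, $r'=k-2-r$; indices mod $n$. In the $(\mathbf x,\mathbf y)$-space: $$T_k:\quad x_i^*=x_{i-r'-1}\frac{x_{i+r}+y_{i+r}}{x_{i-r'-1}+y_{i-r'-1}},\quad y_i^*=y_{i-r'}\frac{x_{i+r+1}+y_{i+r+1}}{x_{i-r'}+y_{i-r'}};$$ $$D_k:\quad x_i^*=\frac1{x_{i+r}}\prod_{j=i-r'}^{i+r-1}\frac{y_j}{x_j},\quad y_i^*=\frac1{x_{i+r+1}}\prod_{j=i-r'}^{i+r}\frac{y_j}{x_j}$$ (the products have $k-2$ and $k-1$ factors respectively). The shift $S_t$ is $(S_t\mathbf x)_i=x_{i+t}$, $(S_t\mathbf y)_i=y_{i+t}$; it commutes with $T_k$ and $D_k$. The factor $(-1)^k$ multiplies all coordinates $x_i,y_i$. *)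

(* Defs.v *)
From HB Require Import structures.
From mathcomp Require Import all_boot all_order all_algebra.
From mathcomp Require Import boolp classical_sets functions reals.
From mathcomp Require Import zify ring.

Set Implicit Arguments.
Unset Strict Implicit.
Unset Printing Implicit Defensive.

Import Order.TTheory GRing.Theory Num.Theory.

Local Open Scope ring_scope.

(* A point of the projective space of E is a line of E, i.e. a subspace of
   dimension 1; a projective subspace is a subspace of E, of projective
   dimension one less than its linear dimension, and the span of points is the
   sum of the corresponding lines. RP^(k-1) is the case E = 'rV[R]_k, and its
   dual space is the case E = 'Hom('rV[R]_k, R^o). *)
Section Polygons.
Context {R : realType} {E : vectType R}.
Implicit Types (V : int -> {vspace E}) (A B C : {vspace E}).

Definition twisted n V : Prop :=
  (forall i : int, \dim (V i) = 1%N) /\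
  exists M : 'End(E), lker M == 0%VS /\
    forall i : int, V (i + n%:Z) = (M @: V i)%VS.

Definition generic k V : Prop :=
  forall i : int, (\sum_(j < k) V (i + j%:Z)%R)%VS = fullv.

Definition corrugated k V : Prop :=
  forall i : int,
    \dim (V i + V (i + 1)%R + V (i + k%:Z - 1)%R + V (i + k%:Z)%R)%VS = 3%N.

Definition collinear A B C : Prop := (\dim (A + B + C)%VS <= 2)%N.

(* V represents a point of P^0_{k,n}. *)
Definition in_P0 k n V : Prop :=
  [/\ twisted n V, generic k V, corrugated k V
    & forall i : int,
      [/\ ~ collinear (V i) (V (i + 1)) (V (i + k%:Z - 1)),
          ~ collinear (V i) (V (i + 1)) (V (i + k%:Z)),
          ~ collinear (V i) (V (i + k%:Z - 1)) (V (i + k%:Z))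
        & ~ collinear (V (i + 1)) (V (i + k%:Z - 1)) (V (i + k%:Z))]].

(* Here + is the span and :&: the intersection; the value is a point only
   when the two lines are distinct and coplanar. *)
Definition F_ k V : int -> {vspace E} := fun i : int =>
  ((V i + V (i + k%:Z - 1)%R) :&: (V (i + 1)%R + V (i + k%:Z)%R))%VS.

Definition G_ k V : int -> {vspace E} := fun i : int =>
  ((V i + V (i + 1)%R) :&: (V (i + k%:Z - 1)%R + V (i + k%:Z)%R))%VS.

(* The subspace of the linear forms vanishing on A, see annihilatorP; when A
   is a hyperplane, this is the point of the dual projective space given
   by A. *)
Definition annihilator A : {vspace 'Hom(E, R^o)} :=
  lker (linfun (fun f : 'Hom(E, R^o) => (f \o projv A)%VF)).

Definition Delta_ k V : int -> {vspace 'Hom(E, R^o)} := fun i : int =>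
  annihilator (\sum_(j < k.-1) V (i + j%:Z)%R)%VS.

Lemma annihilatorP A (f : 'Hom(E, R^o)) :
  (f \in annihilator A) <-> (forall v, v \in A -> f v = 0).
Proof.
have lin : linear (fun f : 'Hom(E, R^o) => (f \o projv A)%VF).
  move=> a g h; apply/lfunP => v.
  by rewrite !(comp_lfunE, add_lfunE, scale_lfunE).
pose m := GRing.isLinear.Build _ _ _ _ _ lin.
pose L : {linear 'Hom(E, R^o) -> 'Hom(E, R^o)} := HB.pack
  (fun f : 'Hom(E, R^o) => (f \o projv A)%VF) m.
rewrite /annihilator memv_ker (lfunE L) /=; split=> [/eqP fA v vA|fA].
  by have /lfunP/(_ v) := fA; rewrite comp_lfunE projv_id // zero_lfunE.
by apply/eqP/lfunP => v; rewrite comp_lfunE zero_lfunE fA // memv_proj.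
Qed.

End Polygons.

Section CoordinateSpace.
Context {R : realType}.

(* A pair (x, y) of sequences indexed by all integers; the coordinate space of
   dimension 2n consists of the pairs satisfying periodic n. *)
Definition xy : choiceType := ((int -> R) * (int -> R))%type.
Implicit Types p : xy.

Definition periodic n p : Prop :=
  forall i : int, p.1 (i + n%:Z) = p.1 i /\ p.2 (i + n%:Z) = p.2 i.

Definition r_ (k : nat) : nat := (k %/ 2 - 1)%N.
Definition r'_ (k : nat) : nat := (k - 2 - r_ k)%N.

Definition shift (t : nat) p : xy :=
  (fun i : int => p.1 (i + t%:Z), fun i : int => p.2 (i + t%:Z)).

Definition scale (c : R) p : xy :=
  (fun i : int => c * p.1 i, fun i : int => c * p.2 i).

Definition T_ k p : xy := let r := (r_ k)%:Z in let r' := (r'_ k)%:Z in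
  (fun i : int => p.1 (i - r' - 1) *
     ((p.1 (i + r) + p.2 (i + r)) / (p.1 (i - r' - 1) + p.2 (i - r' - 1))),
   fun i : int => p.2 (i - r') *
     ((p.1 (i + r + 1) + p.2 (i + r + 1)) / (p.1 (i - r') + p.2 (i - r')))).

(* The domain of definition of the rational map T_ k. *)
Definition T_dom n : set xy :=
  [set p | periodic n p /\ forall i : int, p.1 i + p.2 i != 0].

(* The rational map inverse to T_ k, with domain T_ k @` T_dom n; T_ k is
   injective on T_dom n by T_inj, and the value outside the domain is
   irrelevant. *)
Definition Tinv_ k n : xy -> xy := 'pinv_id (T_dom n) (T_ k).

(* The products run over i - r' <= j <= i + r - 1 and i - r' <= j <= i + r;
   note that r + r' = k - 2. *)
Definition D_ k p : xy := let r := (r_ k)%:Z in let r' := (r'_ k)%:Z in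
  (fun i : int => (p.1 (i + r))^-1 *
     \prod_(j < k - 2) (p.2 (i - r' + j%:Z) / p.1 (i - r' + j%:Z)),
   fun i : int => (p.1 (i + r + 1))^-1 *
     \prod_(j < k - 1) (p.2 (i - r' + j%:Z) / p.1 (i - r' + j%:Z))).

(* The domain of definition of the rational map D_ k. *)
Definition D_dom n : set xy :=
  [set p | periodic n p /\ forall i : int, p.1 i != 0].

Lemma T_inj k n : {in T_dom n &, injective (T_ k)}.
Proof.
move=> p q; rewrite !inE => -[_ p0] [_ q0] eT.
have sumT p1 : (forall i, p1.1 i + p1.2 i != 0) -> forall i,
    (T_ k p1).1 (i - (r_ k)%:Z) + (T_ k p1).2 (i - (r_ k)%:Z - 1)
    = p1.1 i + p1.2 i.
  move=> h i; rewrite /T_ /=; set r := (r_ k)%:Z; set r' := (r'_ k)%:Z.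
  have -> : i - r - 1 - r' = i - r - r' - 1 by ring.
  have -> : i - r - 1 + r + 1 = i by ring.
  by rewrite subrK -mulrDl mulrCA divff ?mulr1.
have s i : p.1 i + p.2 i = q.1 i + q.2 i by rewrite -!sumT // eT.
have nz a b : (p.1 a + p.2 a) / (p.1 b + p.2 b) != 0.
  by rewrite mulf_neq0 ?invr_eq0.
rewrite [p]surjective_pairing [q]surjective_pairing; congr pair;
  apply/funext => i.
  have := congr1 (fun f : xy => f.1 (i + (r'_ k)%:Z + 1)) eT.
  rewrite /T_ /= -!s.
  have -> : i + (r'_ k)%:Z + 1 - (r'_ k)%:Z - 1 = i by ring.
  exact: (mulIf (nz _ _)).
have := congr1 (fun f : xy => f.2 (i + (r'_ k)%:Z)) eT.
rewrite /T_ /= -!s !addrK.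
exact: (mulIf (nz _ _)).
Qed.

End CoordinateSpace.
Arguments xy : clear implicits.

Section Coordinates.
Context {R : realType} {E : vectType R}.
Implicit Types (V : int -> {vspace E}) (v : int -> E) (p : xy R).

Definition lift_of V v : Prop := forall i : int, v i != 0 /\ V i = <[v i]>%VS.

Definition recurrence k v p : Prop :=
  forall i : int, v (i + k%:Z) =
    p.2 (i - 1) *: v i + p.1 i *: v (i + 1) + v (i + k%:Z - 1).

Definition is_coords k n V : set (xy R) :=
  [set p | periodic n p /\ exists v, lift_of V v /\ recurrence k v p].

(* The coordinates of V; they exist and are unique when V is in P^0_{k,n},
   see coordsP and coords_unique. *)
Definition coords k n V : xy R := xget (fun=> 0, fun=> 0) (is_coords k n V).

Lemma free3 (a b c : E) (ka kb kc : R) :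
  ~ collinear <[a]>%VS <[b]>%VS <[c]>%VS ->
  ka *: a + kb *: b + kc *: c = 0 -> [/\ ka = 0, kb = 0 & kc = 0].
Proof.
move=> ncol e.
have fr : free [:: a; b; c].
  rewrite /free eqn_leq dim_span /= leqNgt; apply/negP => lt3; apply: ncol.
  by move: lt3; rewrite /collinear !span_cons span_nil addv0 addvA.
have /freeP/(_ (fun i => [:: ka; kb; kc]`_i)) : free [tuple a; b; c] by [].
rewrite !big_ord_recl big_ord0 /= addr0 addrA => /(_ e) h.
by split; [have := h 0|have := h 1|have := h 2%:R].
Qed.

Lemma lift_unique k V v v' p p' :
  (forall i, ~ collinear (V i) (V (i + 1)) (V (i + k%:Z - 1))) ->
  lift_of V v -> lift_of V v' -> recurrence k v p -> recurrence k v' p' ->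
  p = p'.
Proof.
move=> ncol lv lv' rv rv'.
have /choice [l lE] i : exists l, v' i = l *: v i.
  by apply/vlineP; have [_ <-] := lv i; have [_ ->] := lv' i; rewrite memv_line.
have l0 i : l i != 0.
  by have [] := lv' i; rewrite lE scaler_eq0 negb_or => /andP[].
have eq3 i : [/\ l (i + k%:Z) * p.2 (i - 1) = p'.2 (i - 1) * l i,
    l (i + k%:Z) * p.1 i = p'.1 i * l (i + 1)
    & l (i + k%:Z) = l (i + k%:Z - 1)].
  have := rv' i; rewrite !lE rv !scalerDr !scalerA => /eqP.
  rewrite -subr_eq0 !opprD addrACA [X in X + _]addrACA -!scalerBl => /eqP e.
  have := ncol i; have [[_ ->] [_ ->]] := (lv i, lv (i + 1)).
  have [_ ->] := lv (i + k%:Z - 1) => nc.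
  by have [] := free3 nc e => /subr0_eq -> /subr0_eq -> /subr0_eq ->.
have lS i : l (i + 1) = l i.
  by have [_ _] := eq3 (i + 1 - k%:Z); rewrite subrK addrK.
have lP (m : nat) i : l (i + m%:Z) = l i.
  elim: m => [|m IH]; first by rewrite addr0.
  by rewrite -IH -[RHS]lS; congr l; rewrite -addn1 PoszD addrA.
rewrite [p]surjective_pairing [p']surjective_pairing; congr pair;
  apply/funext => i.
  by have [_ e _] := eq3 i; move: e; rewrite lP lS mulrC => /mulIf; apply.
have [e _ _] := eq3 (i + 1).
by move: e; rewrite lP addrK mulrC => /mulIf; apply.
Qed.

Lemma coords_unique k n V p p' :
  in_P0 k n V -> is_coords k n V p -> is_coords k n V p' -> p = p'.
Proof.
move=> [_ _ _ nc] [_ [v [lv rv]]] [_ [v' [lv' rv']]].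
by apply: lift_unique lv lv' rv rv' => i; have [] := nc i.
Qed.

(* Projectively equivalent polygons have the same coordinates. *)
Lemma is_coords_proj k n V p (M : 'End(E)) : lker M == 0%VS ->
  is_coords k n V p -> is_coords k n (fun i => (M @: V i)%VS) p.
Proof.
move=> M0 [pp [v [lv rv]]]; split=> //; exists (fun i => M (v i)); split=> i.
  have [vi0 ->] := lv i; rewrite limg_line; split=> //.
  by rewrite -(linear0 M) (inj_eq (lker0P M0)).
by rewrite rv !linearD !linearZ.
Qed.

Lemma rescaling (d : int -> R) : (forall i, d i != 0) ->
  exists l : int -> R, forall i, l i != 0 /\ l (i + 1) = l i * d i.
Proof.
move=> d0.
pose l (i : int) := match i with
  | Posz m => \prod_(j < m) d j%:Z
  | Negz m => \prod_(j < m.+1) (d (Negz j))^-1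
  end.
exists l => i; split.
  by case: i => m; apply/prodf_neq0 => j _; rewrite ?invr_eq0.
case: i => [m|[|m]]; first by rewrite -PoszD addn1 /= big_ord_recr.
  by rewrite /= big_ord0 big_ord1 mulVf.
rewrite (_ : Negz m.+1 + 1 = Negz m); last by lia.
by rewrite /= [in RHS]big_ord_recr /= mulfVK.
Qed.

Lemma dim1_line (A : {vspace E}) :
  \dim A = 1%N -> exists u, u != 0 /\ A = <[u]>%VS.
Proof.
move=> A1; exists (vpick A); have u0 : vpick A != 0.
  by rewrite vpick0 -dimv_eq0 A1.
split=> //; apply/eqP; rewrite eq_sym eqEdim dim_vline u0 A1 andbT.
by rewrite -memvE memv_pick.
Qed.

Lemma coordsP k n V : in_P0 k n V -> is_coords k n V (coords k n V).
Proof.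
move=> [[V1 [M [M0 VM]]] _ cor nc]; apply: xgetPex.
have /choice [u uP] i := dim1_line (V1 i).
have uV i : V i = <[u i]>%VS by case: (uP i).
have u0 i : u i != 0 by case: (uP i).
have /choice [c cP] i : exists c : R * R * R, c.2 != 0 /\
    u (i + k%:Z) = c.1.1 *: u i + c.1.2 *: u (i + 1) + c.2 *: u (i + k%:Z - 1).
  have [/negP n1 /negP n2 _ _] := nc i; rewrite -ltnNge in n1.
  rewrite -ltnNge in n2.
  have sub : (V (i + k%:Z)%R <= V i + V (i + 1)%R + V (i + k%:Z - 1)%R)%VS.
    apply/addv_idPl/eqP; rewrite eq_sym eqEdim addvSl cor.
    exact: n1.
  have : u (i + k%:Z) \in (V i + V (i + 1)%R + V (i + k%:Z - 1)%R)%VS.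
    by rewrite memvE -uV.
  rewrite !uV => /memv_addP[w /memv_addP[_ /vlineP[a ->]] [_ /vlineP[b ->] ->]].
  move=> [_ /vlineP[c ->] e]; exists (a, b, c); split=> //=.
  apply/negP => /eqP c0; move: n2; rewrite (addv_idPl _); last first.
    rewrite [X in (X <= _)%VS]uV -memvE e c0 scale0r addr0.
    by rewrite memv_add // uV memvZ // memv_line.
  rewrite ltnNge => /negP; apply.
  by apply: leq_trans (dimv_add_leqif _ _ : (\dim _ <= _)%N) _; rewrite !V1.
have [l lP] : exists l : int -> R, forall i,
    l i != 0 /\ l (i + 1) = l i * ((c (i + 1 - k%:Z)).2)^-1.
  by apply: rescaling => i; rewrite invr_eq0; case: (cP (i + 1 - k%:Z)).
have l0 i : l i != 0 by case: (lP i).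
have lS i : l (i + k%:Z) * (c i).2 = l (i + k%:Z - 1).
  have [_] := lP (i + k%:Z - 1); rewrite subrK addrK => ->.
  by rewrite mulfVK //; case: (cP i).
pose v i := l i *: u i.
pose p : xy R := (fun i : int => l (i + k%:Z) * (c i).1.2 / l (i + 1),
  fun i : int => l (i + 1 + k%:Z) * (c (i + 1)).1.1 / l (i + 1)).
have lv : lift_of V v.
  move=> i; rewrite /v scaler_eq0 negb_or l0 u0; split=> //.
  rewrite uV; apply/eqP; rewrite eqEdim !dim_vline scaler_eq0 negb_or l0 u0.
  rewrite leqnn andbT -memvE; apply/vlineP; exists (l i)^-1.
  by rewrite scalerA mulVf // scale1r.
have rv : recurrence k v p.
  move=> i; have [_ e] := cP i.
  by rewrite /v e /p /= subrK !scalerDr !scalerA !divfK // lS.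
exists p; split; last by exists v.
move: lv rv; clearbody v p => lv rv.
have lvn : lift_of (fun i => V (i + n%:Z)) (fun i => v (i + n%:Z)) by move=> i.
have lvM : lift_of (fun i => V (i + n%:Z)) (fun i => M (v i)).
  move=> i; have [vi0 Vi] := lv i; rewrite VM Vi limg_line; split=> //.
  by rewrite -(linear0 M) (inj_eq (lker0P M0)).
have rvM : recurrence k (fun i => M (v i)) p.
  by move=> i; rewrite rv !linearD !linearZ.
have rvn : recurrence k (fun i => v (i + n%:Z)) (shift n p).
  move=> i; rewrite /shift /= (addrAC i k%:Z) rv.
  rewrite (addrAC i (-1) n%:Z) (addrAC i 1 n%:Z); congr (_ + v _); ring.
have e : p = shift n p.
  apply: lift_unique lvM lvn rvM rvn => i.
  have -> : i + k%:Z - 1 + n%:Z = i + n%:Z + k%:Z - 1 by ring.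
  by rewrite (addrAC i 1); case: (nc (i + n%:Z)).
move=> i; split.
  exact: esym (congr1 (fun q : xy R => q.1 i) e).
exact: esym (congr1 (fun q : xy R => q.2 i) e).
Qed.

End Coordinates.

(* Main.v *)
(* In the lift v of V normalised by v_(i+k) = y_(i-1) v_i + x_i v_(i+1)
   + v_(i+k-1), moving one term of the relation to the left-hand side exhibits
   lifts of the images:
   w_i = y_(i-1) v_i + v_(i+k-1) = v_(i+k) - x_i v_(i+1)  for F, and
   u_i = y_(i-1) v_i + x_i v_(i+1) = v_(i+k) - v_(i+k-1)  for G.
   The first satisfies w_(i+1) - w_i = (x_i + y_i) v_(i+1), whence a recurrence
   which is already normalised; the second one becomes normalised after
   division by x_i + y_(i-1).  For the duality, let phi_i be the linear form
   which vanishes at v_i, ..., v_(i+k-2) and is 1 at v_(i+k-1); evaluation at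
   v_(i+k-1), ..., v_(i+2k-2) gives
   y_(i+k-2) phi_(i+k) = phi_i - phi_(i+1) - x_(i+k-2) phi_(i+k-1),
   and the rescaling which normalises this relation multiplies phi_(i+1) by
   - y_(i-1) / x_(i-1) relative to phi_i; its iterates are the products in D.
   In all cases the polygon is in P^0 as soon as it is generic and the
   coefficients of its normalised recurrence are nonzero. *)
Require Import Defs.
From HB Require Import structures.
From mathcomp Require Import all_boot all_order all_algebra.
From mathcomp Require Import boolp classical_sets functions reals.
From mathcomp Require Import zify ring.

Set Implicit Arguments.
Unset Strict Implicit.
Unset Printing Implicit Defensive.

Import Order.TTheory GRing.Theory Num.Theory.
Import VectorInternalTheory.

Local Open Scope ring_scope.

(** * Vector identities reduced to scalar identities in each coordinate, within reach of [ring] and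
    [field] *)

Section Coordinatewise.
Context {R : fieldType} {E : vectType R}.

Lemma v2rD (u w : E) : v2r (u + w) = v2r u + v2r w.
Proof. exact: linearD. Qed.

Lemma v2rN (u : E) : v2r (- u) = - v2r u.
Proof. exact: linearN. Qed.

Lemma v2rZ (c : R) (u : E) : v2r (c *: u) = c *: v2r u.
Proof. exact: linearZ. Qed.

End Coordinatewise.

Ltac coordinatewise :=
  apply: v2r_inj; rewrite !(v2rD, v2rN, v2rZ); apply/rowP => ?; rewrite !mxE.

Lemma r_r' k : (2 < k)%N -> (r_ k + r'_ k = k - 2)%N.
Proof. by rewrite /r'_ /r_ => k3; lia. Qed.

(** * Spans and intersections of lines, and collinearity *)

Section Lines.
Context {R : realType} {E : vectType R}.
Implicit Types (A B : {vspace E}) (a b c d w : E) (v : int -> E).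

(** The dimension formula leaves at most 2 + 2 - 3 = 1 for the intersection, which already contains
    the line of [w]. *)
Lemma line_capv A B w : (\dim A <= 2)%N -> (\dim B <= 2)%N ->
  \dim (A + B) = 3%N -> w \in A -> w \in B -> w != 0 -> (A :&: B)%VS = <[w]>%VS.
Proof.
move=> A2 B2 AB3 wA wB w0; apply/eqP; rewrite eq_sym eqEdim -memvE memv_cap.
by rewrite wA wB dim_vline w0 /=; have := dimv_sum_cap A B; lia.
Qed.

Lemma dim_line2 a b : (\dim (<[a]> + <[b]>) <= 2)%N.
Proof.
apply: leq_trans (dimv_add_leqif _ _ : (\dim _ <= _)%N) _.
by rewrite !dim_vline; do 2 case: (_ != 0).
Qed.

Lemma addv_line_replace a b c d (x y z : R) : z != 0 ->
  d = x *: a + y *: b + z *: c ->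
  (<[a]> + <[b]> + <[d]>)%VS = (<[a]> + <[b]> + <[c]>)%VS.
Proof.
move=> z0 dE; apply/eqP.
rewrite eqEsubv subv_add [X in _ && X]subv_add !addvSl /=.
rewrite -!memvE; apply/andP; split; first rewrite dE.
  by rewrite !memv_add ?memvZ ?memv_line.
have -> : c = z^-1 *: (- (x *: a + y *: b) + d).
  by rewrite dE addKr scalerA mulVf // scale1r.
by rewrite memvZ // memv_add ?memv_line // rpredN memv_add ?memvZ ?memv_line.
Qed.

(** All three coefficients of [d] are nonzero, so [d] can be exchanged for any one of [a], [b], [c]
    without changing the span. *)
Lemma four_lines a b c d (x y : R) : x != 0 -> y != 0 ->
  d = y *: a + x *: b + c ->
  \dim (<[a]> + <[b]> + <[c]>) = 3%N ->
  [/\ \dim (<[a]> + <[b]> + <[c]> + <[d]>) = 3%N,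
      ~ collinear <[a]>%VS <[b]>%VS <[d]>%VS,
      ~ collinear <[a]>%VS <[c]>%VS <[d]>%VS
    & ~ collinear <[b]>%VS <[c]>%VS <[d]>%VS].
Proof.
move=> x0 y0 dE d3; rewrite /collinear; split.
- rewrite (addv_idPl _) // -memvE dE.
  by rewrite !memv_add ?memvZ ?memv_line.
- by rewrite (@addv_line_replace a b c d y x 1) ?oner_eq0 ?scale1r ?d3.
- rewrite (@addv_line_replace a c b d y 1 x) ?scale1r //; last first.
    by rewrite addrAC.
  by rewrite -addvA (addvC <[c]>%VS) addvA d3.
rewrite (@addv_line_replace b c a d x 1 y) ?scale1r //; last first.
  by rewrite dE -addrA addrC.
by rewrite addvC addvA d3.
Qed.

End Lines.

(** * Genericity, monodromy and membership in P^0, read off from a normalised lift *)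

Section Polygons.
Context {R : realType} {E : vectType R}.
Implicit Types (V W : int -> {vspace E}) (v : int -> E) (p : xy R).

Definition window k v (i : int) : k.-tuple E := [tuple v (i + j%:Z) | j < k].

Lemma lift_of_scale V v (c : int -> R) : lift_of V v ->
  (forall i, c i != 0) -> lift_of V (fun i => c i *: v i).
Proof.
move=> lv c0 i; have [v0 ->] := lv i.
rewrite scaler_eq0 negb_or c0 v0; split=> //.
apply/eqP; rewrite eq_sym eqEdim !dim_vline scaler_eq0 negb_or c0 v0.
by rewrite leqnn andbT -memvE memvZ // memv_line.
Qed.

Lemma nth_window k v i (j : nat) : (j < k)%N ->
  (window k v i)`_j = v (i + j%:Z).
Proof. by move=> jk; rewrite -(tnth_nth _ _ (Ordinal jk)) tnth_mktuple. Qed.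

Lemma span_window k V v i : lift_of V v ->
  <<window k v i>>%VS = (\sum_(j < k) V (i + j%:Z)%R)%VS.
Proof.
move=> lv; rewrite span_def big_tuple; apply: eq_bigr => j _.
by rewrite tnth_mktuple; have [_ <-] := lv (i + j%:Z).
Qed.

Lemma generic_window k V v : \dim {:E} = k -> lift_of V v ->
  generic k V <-> forall i, free (window k v i).
Proof.
move=> dE lv; split=> g i.
  by rewrite /free (span_window _ _ lv) g dE size_tuple.
apply/eqP; rewrite -(span_window _ _ lv) eqEdim subvf dE.
by have := g i; rewrite /free size_tuple => /eqP ->; rewrite leqnn.
Qed.

(** The window starting at [i] spans the whole space, and its other k - 3 vertices account for at
    most k - 3 dimensions, so these three account for at least 3. *)
Lemma generic_dim3 k V i : (2 < k)%N -> \dim {:E} = k ->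
  (forall j, \dim (V j) = 1%N) -> generic k V ->
  \dim (V i + V (i + 1)%R + V (i + k%:Z - 1)%R) = 3%N.
Proof.
move=> k3 dE V1 g; apply/eqP; rewrite eqn_leq; apply/andP; split.
  apply: leq_trans (dimv_add_leqif _ _ : (\dim _ <= _)%N) _.
  rewrite V1 addn1 ltnS.
  by apply: leq_trans (dimv_add_leqif _ _ : (\dim _ <= _)%N) _; rewrite !V1.
set A := (_ + _ + _)%VS.
pose B := (\sum_(j < k - 3) V (i + 2 + j%:Z)%R)%VS.
have : (fullv <= A + B)%VS.
  rewrite -(g i); apply/subv_sumP => j _.
  have [j0|j0] := eqVneq (j : nat) 0%N.
    rewrite j0 addr0; apply: subv_trans (addvSl _ _).
    by rewrite /A -addvA addvSl.
  have [j1|j1] := eqVneq (j : nat) 1%N.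
    rewrite j1; apply: subv_trans (addvSl _ _).
    by apply: subv_trans (addvSl _ _); apply: addvSr.
  have [jk|jk] := eqVneq (j : nat) k.-1.
    rewrite jk (_ : i + k.-1%:Z = i + k%:Z - 1); last by lia.
    by apply: subv_trans (addvSl _ _); apply: addvSr.
  apply: subv_trans (addvSr _ _).
  have jlt : (j - 2 < k - 3)%N by have := ltn_ord j; lia.
  rewrite (_ : i + j%:Z = i + 2 + (Ordinal jlt)%:Z); last by rewrite /=; lia.
  exact: (@sumv_sup _ _ _ (Ordinal jlt)).
move/dimvS; rewrite dE => kAB.
have : (\dim B <= k - 3)%N.
  apply: (leq_trans (dimv_leq_sum _ _ _)).
  by rewrite (eq_bigr (fun=> 1%N)) ?sum1_card ?card_ord // => j _; rewrite V1.
have := (dimv_add_leqif A B : (\dim _ <= _)%N); lia.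
Qed.

(* The coefficients y_(i-1) are nonzero, so the recurrence propagates zeros
   backwards as well as forwards. *)
Lemma recurrence_eq0 k v p : (1 < k)%N -> recurrence k v p ->
  (forall i, p.2 i != 0) -> (forall j, (j < k)%N -> v j%:Z = 0) ->
  forall i, v i = 0.
Proof.
move=> k2 rv y0 v0 i.
(* Strengthened to a whole window of zeros, the form that moves one step in either direction. *)
suff : forall i (j : nat), (j < k)%N -> v (i + j%:Z) = 0.
  by move=> /(_ i 0%N); rewrite addr0; apply; lia.
elim/int_rect => [j jk|m IH j jk|m IH j jk]; first by rewrite add0r v0.
  have [jlt|jge] := ltnP j.+1 k.
    by rewrite (_ : _ + _ = m%:Z + j.+1%:Z); [exact: IH|lia].
  rewrite (_ : m.+1%:Z + j%:Z = m%:Z + k%:Z); last by lia.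
  have vm := IH 0%N (ltnW k2); rewrite addr0 in vm.
  rewrite rv vm (IH 1%N k2) (_ : m%:Z + k%:Z - 1 = m%:Z + k.-1%:Z); last by lia.
  by rewrite IH ?scaler0 ?addr0 // prednK // ltnW.
case: j jk => [|j] jk; last first.
  by rewrite (_ : _ + _ = - m%:Z + j%:Z); [apply: IH; lia|lia].
have := rv (- m.+1%:Z).
rewrite (_ : - m.+1%:Z + k%:Z = - m%:Z + k.-1%:Z); last by lia.
rewrite (_ : - m.+1%:Z + 1 = - m%:Z + 0%:Z); last by lia.
rewrite (_ : - m%:Z + k.-1%:Z - 1 = - m%:Z + k.-2%:Z); last by lia.
rewrite !IH; try lia.
rewrite scaler0 !addr0 => /esym/eqP; rewrite scaler_eq0 (negPf (y0 _)) /=.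
by move/eqP.
Qed.

(** [M] is prescribed on the basis [v 0], ..., [v (k - 1)]. By periodicity, [M (v i)] and
    [v (i + n)] obey the same linear recurrence, so their difference vanishes everywhere once it
    does on this window. *)
Lemma monodromy_ex k n V v p : (1 < k)%N -> \dim {:E} = k ->
  lift_of V v -> generic k V -> recurrence k v p -> periodic n p ->
  (forall i, p.2 i != 0) ->
  exists M : 'End(E), lker M == 0%VS /\ forall i, M (v i) = v (i + n%:Z).
Proof.
move=> k2 dE lv gV rv pp y0.
have /(generic_window dE lv) fr := gV.
pose f (u : E) := \sum_(j < k) coord (window k v 0) j u *: v (j%:Z + n%:Z).
have flin : linear f.
  move=> a u u'; rewrite /f scaler_sumr -big_split; apply: eq_bigr => j _.
  by rewrite linearP scalerDl scalerA.
pose m := GRing.isLinear.Build _ _ _ _ _ flin.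
pose L : {linear E -> E} := HB.pack f m.
pose M : 'End(E) := linfun L.
have Mv j : (j < k)%N -> M (v j%:Z) = v (j%:Z + n%:Z).
  move=> jk; rewrite lfunE /= /f (bigD1 (Ordinal jk)) //=.
  have cE l : coord (window k v 0) l (v j) = (Ordinal jk == l)%:R.
    by rewrite -(coord_free (Ordinal jk) l (fr 0)) nth_window ?add0r.
  rewrite cE eqxx scale1r big1 ?addr0 // => l; rewrite cE eq_sym => /negPf ->.
  by rewrite scale0r.
have MvE i : M (v i) = v (i + n%:Z).
  apply/subr0_eq; move: i.
  apply: (@recurrence_eq0 k (fun i => M (v i) - v (i + n%:Z)) p k2) => //
    [i|j jk].
    have := rv (i + n%:Z).
    have [-> _] := pp i; rewrite (addrAC i n%:Z (-1)).
    have [_ ->] := pp (i - 1).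
    rewrite !(addrAC i n%:Z) (addrAC _ n%:Z (-1)) => ->.
    rewrite (rv i) !linearD !linearZ /=; coordinatewise; ring.
  by rewrite Mv // subrr.
exists M; split=> //.
(* The image contains the window starting at [n], which spans by genericity; rank-nullity then kills
   the kernel. *)
have Mfull : limg M = fullv.
  apply/eqP; rewrite eqEsubv subvf -[X in (X <= _)%VS](gV n%:Z).
  apply/subv_sumP => j _.
  have [_ ->] := lv (n%:Z + j%:Z).
  by rewrite -memvE (addrC n%:Z) -MvE memv_img ?memvf.
have := limg_ker_dim M fullv; rewrite Mfull capfv => /eqP.
by rewrite -[X in _ == X]add0n eqn_add2r dimv_eq0.
Qed.

(** The criterion applied to all three image polygons. Genericity makes three of the four points
    independent, [four_lines] supplies the plane and the other non-collinearities, and [p] is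
    identified by uniqueness of coordinates. *)
Lemma P0_coords_intro k n V v p : (2 < k)%N -> \dim {:E} = k ->
  lift_of V v -> generic k V -> recurrence k v p -> periodic n p ->
  (forall i, p.1 i != 0) -> (forall i, p.2 i != 0) ->
  in_P0 k n V /\ coords k n V = p.
Proof.
move=> k3 dE lv gV rv pp x0 y0.
have V1 i : \dim (V i) = 1%N by have [v0 ->] := lv i; rewrite dim_vline v0.
have d3 i := generic_dim3 i k3 dE V1 gV.
have four i := four_lines (x0 i) (y0 (i - 1)) (rv i).
have inP : in_P0 k n V.
  split=> // [|i|i].
  - split=> //; have [M [M0 MvE]] := monodromy_ex (ltnW k3) dE lv gV rv pp y0.
    exists M; split=> // i; have [_ ->] := lv i; have [_ ->] := lv (i + n%:Z).
    by rewrite limg_line MvE.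
  - move: (d3 i); rewrite !(proj2 (lv _)) => /(four i).
    by case.
  - move: (d3 i); rewrite /collinear !(proj2 (lv _)) => d3i.
    by have [_ ? ? ?] := four i d3i; split=> //; rewrite d3i.
split=> //; apply: coords_unique inP (coordsP inP) _.
by split=> //; exists v.
Qed.

(** If x_i = 0, the relation puts V_i, V_(i+k-1), V_(i+k) on a line; if y_i = 0, it does so for
    V_(i+2), V_(i+k), V_(i+k+1). *)
Lemma P0_coords_elim k n V : in_P0 k n V ->
  exists v, [/\ lift_of V v, recurrence k v (coords k n V),
    forall i, (coords k n V).1 i != 0 & forall i, (coords k n V).2 i != 0].
Proof.
move=> inP; have [_ [v [lv rv]]] := coordsP inP; exists v; split=> // i.
  have [_ _ _ /(_ i)[_ _ nc _]] := inP.
  apply: contra_not_neq nc => x0; rewrite /collinear.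
  rewrite (addv_idPl _) ?(proj2 (lv _)) ?dim_line2 //.
  rewrite -memvE rv x0 scale0r addr0.
  by rewrite memv_add ?memvZ ?memv_line.
have [_ _ _ /(_ (i + 1))[_ _ _ nc]] := inP.
apply: contra_not_neq nc => y0; rewrite /collinear.
rewrite (addv_idPl _) ?(proj2 (lv _)) ?dim_line2 //.
rewrite -memvE rv addrK y0 scale0r add0r.
by rewrite memv_add ?memvZ ?memv_line.
Qed.

End Polygons.

(** * The maps F and G and the coordinate map T *)

Section PentagramMaps.
Context {R : realType} {E : vectType R}.
Implicit Types (V W : int -> {vspace E}) (v : int -> E) (p : xy R).

(** The shift cancels the centring of the indices; since r + r' = k - 2, the parity of k disappears
    from the formula. *)
Lemma T_shift k p : (2 < k)%N -> T_ k (shift (r'_ k + 1) p) =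
  (fun i : int => p.1 i *
     ((p.1 (i + k%:Z - 1) + p.2 (i + k%:Z - 1)) / (p.1 i + p.2 i)),
   fun i : int => p.2 (i + 1) *
     ((p.1 (i + k%:Z) + p.2 (i + k%:Z)) / (p.1 (i + 1) + p.2 (i + 1)))).
Proof.
move=> k3; have rE := r_r' k3.
rewrite /T_ /shift /=; congr pair; apply/funext => i.
  rewrite (_ : i - (r'_ k)%:Z - 1 + (r'_ k + 1)%N%:Z = i); last by lia.
  by rewrite (_ : i + (r_ k)%:Z + (r'_ k + 1)%N%:Z = i + k%:Z - 1); last by lia.
rewrite (_ : i - (r'_ k)%:Z + (r'_ k + 1)%N%:Z = i + 1); last by lia.
by rewrite (_ : i + (r_ k)%:Z + 1 + (r'_ k + 1)%N%:Z = i + k%:Z); last by lia.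
Qed.

(* The preimage is found from T being invertible: if T q = S_(r+1) p, then
   q.x_i + q.y_i = p.x_(i+1) + p.y_i. *)
Definition T_preimage k p : xy R :=
  let s (i : int) := p.1 (i + 1) + p.2 i in
  (fun i : int => p.1 (i + k%:Z) * (s i / s (i + k%:Z - 1)),
   fun i : int => p.2 (i + k%:Z - 1) * (s i / s (i + k%:Z - 1))).

Lemma T_preimageK k n p : (2 < k)%N -> periodic n p ->
  (forall i, p.1 (i + 1) + p.2 i != 0) ->
  T_dom n (T_preimage k p) /\ T_ k (T_preimage k p) = shift (r_ k + 1) p.
Proof.
move=> k3 pp s0; have rE := r_r' k3; set q := T_preimage k p.
pose s i := p.1 (i + 1) + p.2 i.
have {}s0 i : s i != 0 by exact: s0.
(* Both coordinates of [q] carry the ratio [s i / s (i + k - 1)], and the remaining factors add up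
   to its denominator. *)
have sE i : q.1 i + q.2 i = s i.
  have sk : p.1 (i + k%:Z) + p.2 (i + k%:Z - 1) = s (i + k%:Z - 1).
    by rewrite /s subrK.
  by rewrite /q /= -mulrDl sk mulrCA divff ?mulr1.
split.
  split=> i; last by rewrite sE s0.
  rewrite /q /= !(addrAC _ n%:Z).
  by rewrite !(proj1 (pp _)) !(proj2 (pp _)).
rewrite /T_ /shift; congr pair; apply/funext => i; rewrite !sE /= -!/(s _).
  rewrite (_ : i - (r'_ k)%:Z - 1 + k%:Z = i + (r_ k + 1)%N%:Z); last by lia.
  rewrite (_ : i + (r_ k + 1)%N%:Z - 1 = i + (r_ k)%:Z); last by lia.
  by field; rewrite !s0.
rewrite (_ : i - (r'_ k)%:Z + k%:Z - 1 = i + (r_ k + 1)%N%:Z); last by lia.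
rewrite (_ : i + (r_ k)%:Z + 1 = i + (r_ k + 1)%N%:Z); last by lia.
by field; rewrite !s0.
Qed.

Lemma T_image k n p : (2 < k)%N -> periodic n p ->
  (T_ k @` T_dom n)%classic (shift (r_ k + 1) p) <->
  (forall i, p.1 (i + 1) + p.2 i != 0).
Proof.
move=> k3 pp; split; last first.
  by move=> s0; have [dq Tq] := T_preimageK k3 pp s0; exists (T_preimage k p).
move=> [q [_ q0] Tq] i; have rE := r_r' k3.
(* At these two indices the coordinates of [T_ k q] share one ratio, and their sum collapses to
   [q.1 i + q.2 i]. *)
have := congr1 (fun f : xy R => f.1 (i - (r_ k)%:Z)) Tq.
have := congr1 (fun f : xy R => f.2 (i - (r_ k)%:Z - 1)) Tq.
rewrite /T_ /shift /= subrK.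
rewrite (_ : i - (r_ k)%:Z - 1 + (r_ k)%:Z + 1 = i); last by lia.
rewrite (_ : i - (r_ k)%:Z - 1 + (r_ k + 1)%N%:Z = i); last by lia.
rewrite (_ : i - (r_ k)%:Z + (r_ k + 1)%N%:Z = i + 1); last by lia.
rewrite (addrAC (i - _) (-1)) => <- <-.
by rewrite -mulrDl mulrCA divff ?mulr1.
Qed.

Lemma Tinv_shift k n p : (2 < k)%N -> periodic n p ->
  (forall i, p.1 (i + 1) + p.2 i != 0) ->
  Tinv_ k n (shift (r_ k + 1) p) = T_preimage k p.
Proof.
move=> k3 pp s0; have [dq <-] := T_preimageK k3 pp s0.
by rewrite /Tinv_ pinvKV ?inE //; exact: T_inj.
Qed.

(** The two expressions of the vector put it on both lines; by corrugation these span a plane, so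
    [line_capv] applies. *)
Lemma F_lift k n V v : in_P0 k n V -> lift_of V v ->
  recurrence k v (coords k n V) ->
  lift_of (F_ k V)
    (fun i => (coords k n V).2 (i - 1) *: v i + v (i + k%:Z - 1)).
Proof.
move=> [_ _ cor nc] lv rv i; set w := (_ + _).
have w0 : w != 0.
  have [nc1 _ _ _] := nc i; rewrite !(proj2 (lv _)) in nc1.
  apply/eqP => w0.
  have e : (coords k n V).2 (i - 1) *: v i + 0 *: v (i + 1) +
      1 *: v (i + k%:Z - 1) = 0 by rewrite scale0r addr0 scale1r.
  by have [_ _ /eqP] := free3 nc1 e; rewrite oner_eq0.
split=> //; apply: line_capv => //.
- by rewrite !(proj2 (lv _)) dim_line2.
- by rewrite !(proj2 (lv _)) dim_line2.
- by rewrite -(cor i) addvA -(addvA (V i)) (addvC (V (i + k%:Z - 1))) addvA.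
- by rewrite !(proj2 (lv _)) memv_add ?memvZ ?memv_line.
rewrite (_ : w = (- (coords k n V).1 i) *: v (i + 1) + v (i + k%:Z)).
  by rewrite !(proj2 (lv _)) memv_add ?memvZ ?memv_line.
by rewrite rv /w; coordinatewise; ring.
Qed.

Lemma F_coords k n V : (2 < k)%N -> \dim {:E} = k -> in_P0 k n V ->
  (forall i, (coords k n V).1 i + (coords k n V).2 i != 0) ->
  in_P0 k n (F_ k V) /\
  coords k n (F_ k V) = T_ k (shift (r'_ k + 1) (coords k n V)).
Proof.
move=> k3 dE inP z0.
have [v [lv rv x0 y0]] := P0_coords_elim inP.
have [pp _] := coordsP inP; have [_ gV _ _] := inP.
have lw := F_lift inP lv rv.
move: lw z0 rv x0 y0 pp; set p := coords k n V; clearbody p.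
set w := fun i => _; move=> lw z0 rv x0 y0 pp.
have wB i : w (i + 1) - w i = (p.1 i + p.2 i) *: v (i + 1).
  by rewrite /w addrK (addrAC i 1) addrK rv; coordinatewise; ring.
(* Eliminating [v (i + k)] between this identity and [wB] at [i + k - 1] gives the recurrence for
   [w]. *)
have wC i : p.1 i *: w (i + 1) + p.2 i *: w i = (p.1 i + p.2 i) *: v (i + k%:Z).
  by rewrite /w addrK (addrAC i 1) addrK rv; coordinatewise; ring.
rewrite T_shift //; apply: (P0_coords_intro k3 dE lw) => // [i|i|i|i|i] /=.
- apply/eqP; rewrite eqEsubv subvf -[X in (X <= _)%VS](gV i).
  set U := (X in (_ <= X)%VS).
  have wU j : (j < k)%N -> w (i + j%:Z) \in U.
    move=> jk; have [_ e] := lw (i + j%:Z); rewrite memvE -e.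
    exact: (@sumv_sup _ _ _ (Ordinal jk)).
  (* Differences of consecutive [w] recover [v (i + 1)], ..., [v (i + k - 1)]; then [v i] is
     extracted from [w i], as y_(i-1) is nonzero. *)
  have vU j : (j.+1 < k)%N -> v (i + j.+1%:Z) \in U.
    move=> jk; rewrite (_ : v _ = (p.1 (i + j%:Z) + p.2 (i + j%:Z))^-1 *:
        (w (i + j.+1%:Z) - w (i + j%:Z))).
      by rewrite memvZ // rpredB // wU // ltnW.
    rewrite (_ : i + j.+1%:Z = i + j%:Z + 1); last by lia.
    by rewrite wB scalerA mulVf ?scale1r.
  apply/subv_sumP => -[[|j] jk] _ /=; rewrite (proj2 (lv _)).
    rewrite -memvE addr0.
    rewrite (_ : v i = (p.2 (i - 1))^-1 *: (w i - v (i + k.-2.+1%:Z))).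
      by rewrite memvZ // rpredB ?vU //; [rewrite -[i]addr0 wU|lia].
    rewrite /w (_ : i + k.-2.+1%:Z = i + k%:Z - 1); last by lia.
    by rewrite addrK scalerA mulVf ?scale1r.
  by rewrite -memvE vU.
- rewrite (_ : w (i + k%:Z) = w (i + k%:Z - 1) +
     (p.1 (i + k%:Z - 1) + p.2 (i + k%:Z - 1)) *: v (i + k%:Z)); last first.
    have := wB (i + k%:Z - 1); rewrite subrK => <-.
    by rewrite (addrC (w _)) subrK.
  have -> : v (i + k%:Z) =
      (p.1 i + p.2 i)^-1 *: (p.1 i *: w (i + 1) + p.2 i *: w i).
    by rewrite wC scalerA mulVf ?scale1r.
  rewrite subrK (_ : i - 1 + k%:Z = i + k%:Z - 1); last by lia.
  coordinatewise; ring.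
- rewrite !(addrAC _ n%:Z).
  by rewrite !(proj1 (pp _)) !(proj2 (pp _)).
- by rewrite !mulf_neq0 ?invr_eq0 ?z0.
- by rewrite !mulf_neq0 ?invr_eq0 ?z0.
Qed.

(** If x_i + y_i = 0, then w_(i+1) = w_i, so two consecutive vertices of the image coincide. *)
Lemma F_dom k n V : in_P0 k n V ->
  in_P0 k n (F_ k V) -> forall i, (coords k n V).1 i + (coords k n V).2 i != 0.
Proof.
move=> inP [_ _ _ nc] i.
have [v [lv rv x0 y0]] := P0_coords_elim inP.
have lw := F_lift inP lv rv.
have [nc1 _ _ _] := nc i; apply: contra_not_neq nc1 => z0.
rewrite /collinear !(proj2 (lw _)).
set p := coords k n V in z0 rv x0 y0 *.
rewrite [X in (_ + <[X]> + _)%VS](_ : _ =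
    p.2 (i - 1) *: v i + v (i + k%:Z - 1)).
  by rewrite addvv dim_line2.
rewrite addrK (addrAC i 1) addrK rv.
apply/subr0_eq; rewrite (_ : _ - _ = (p.1 i + p.2 i) *: v (i + 1)); last first.
  by coordinatewise; ring.
by rewrite z0 scale0r.
Qed.

Lemma G_lift k n V v : in_P0 k n V -> lift_of V v ->
  recurrence k v (coords k n V) ->
  lift_of (G_ k V) (fun i => v (i + k%:Z) - v (i + k%:Z - 1)).
Proof.
move=> inP lv rv i; set w := (_ - _).
have [_ _ cor nc] := inP.
have wE : w = (coords k n V).2 (i - 1) *: v i + (coords k n V).1 i *: v (i + 1).
  by rewrite /w rv addrK.
have w0 : w != 0.
  have [_ _ nc1 _] := nc i; rewrite !(proj2 (lv _)) in nc1.
  apply/eqP => w0.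
  have e : 0 *: v i + -1 *: v (i + k%:Z - 1) + 1 *: v (i + k%:Z) = 0.
    by rewrite scale0r add0r scaleN1r scale1r addrC.
  by have [_ _ /eqP] := free3 nc1 e; rewrite oner_eq0.
split=> //; apply: line_capv => //.
- by rewrite !(proj2 (lv _)) dim_line2.
- by rewrite !(proj2 (lv _)) dim_line2.
- by rewrite addvA.
- by rewrite wE !(proj2 (lv _)) memv_add ?memvZ ?memv_line.
by rewrite !(proj2 (lv _)) addvC memv_add ?memv_line // rpredN memv_line.
Qed.

(** With u_i = v_(i+k) - v_(i+k-1), adding y_(i+k-2) u_i to u_(i+k-1) cancels its term in
    v_(i+k-1). *)
Lemma G_relation k v p i : recurrence k v p ->
  (v (i + k%:Z - 1 + k%:Z) - v (i + k%:Z - 1 + k%:Z - 1)) +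
    p.2 (i + k%:Z - 1 - 1) *: (v (i + k%:Z) - v (i + k%:Z - 1)) =
  (p.1 (i + k%:Z - 1) + p.2 (i + k%:Z - 1 - 1)) *: v (i + k%:Z).
Proof.
by move=> rv; rewrite (rv (i + k%:Z - 1)) subrK; coordinatewise; ring.
Qed.

Lemma G_dom k n V : in_P0 k n V -> in_P0 k n (G_ k V) ->
  forall i, (coords k n V).1 (i + 1) + (coords k n V).2 i != 0.
Proof.
move=> inP [_ _ _ nc] i.
have [v [lv rv _ _]] := P0_coords_elim inP.
have lw := G_lift inP lv rv.
(* Chosen so that the coefficient in [G_relation m] is x_(i+1) + y_i; if it vanishes, vertices [m]
   and [m + k - 1] of the image coincide. *)
pose m : int := i + 2 - k%:Z.
have [nc1 _ _ _] := nc m; apply: contra_not_neq nc1 => s0.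
rewrite /collinear !(proj2 (lw _)) (addv_idPl _) ?dim_line2 //.
apply: subv_trans (addvSl _ _); rewrite -memvE; apply/vlineP.
exists (- (coords k n V).2 i); apply/subr0_eq.
have := G_relation m rv.
rewrite (_ : m + k%:Z - 1 - 1 = i); last by rewrite /m; lia.
rewrite (_ : m + k%:Z - 1 = i + 1); last by rewrite /m; lia.
by rewrite s0 scale0r scaleNr opprK.
Qed.

Lemma G_coords k n V : (2 < k)%N -> \dim {:E} = k -> in_P0 k n V ->
  (forall i, (coords k n V).1 (i + 1) + (coords k n V).2 i != 0) ->
  in_P0 k n (G_ k V) /\
  coords k n (G_ k V) =
    Tinv_ k n (shift (r_ k + 1) (coords k n V)).
Proof.
move=> k3 dE inP s0.
have [v [lv rv x0 y0]] := P0_coords_elim inP.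
have [pp _] := coordsP inP; have [_ gV _ _] := inP.
have lu := G_lift inP lv rv.
move: s0 rv x0 y0 pp; set p := coords k n V; clearbody p.
move=> s0 rv x0 y0 pp.
rewrite Tinv_shift //.
pose s i := p.1 (i + 1) + p.2 i.
have {}s0 i : s i != 0 by exact: s0.
pose u i := v (i + k%:Z) - v (i + k%:Z - 1).
have uE i : u (i + k%:Z - 1) + p.2 (i + k%:Z - 1 - 1) *: u i =
    s (i + k%:Z - 1 - 1) *: v (i + k%:Z).
  by rewrite /s subrK; exact: G_relation.
have lt : lift_of (G_ k V) (fun i => (s (i - 1))^-1 *: u i).
  by apply: lift_of_scale => // i; rewrite invr_eq0.
apply: (P0_coords_intro k3 dE lt) => // [i|i|i|i|i] /=.
- apply/eqP; rewrite eqEsubv subvf -[X in (X <= _)%VS](gV (i + k%:Z - 1)).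
  set U := (X in (_ <= X)%VS).
  have uU j : (j < k)%N -> u (i + j%:Z) \in U.
    move=> jk; have [_ e] := lu (i + j%:Z); rewrite memvE -e.
    exact: (@sumv_sup _ _ _ (Ordinal jk)).
  (* First [v (i + k)] comes from [uE], then [v (i + k - 1)] by subtracting [u i]; each later vertex
     is reached by adding the next [u]. *)
  have vU j : (j < k)%N -> v (i + k%:Z - 1 + j%:Z) \in U.
    elim: j => [|j IH] jk; last first.
      rewrite (_ : v _ = v (i + k%:Z - 1 + j%:Z) + u (i + j%:Z)).
        by rewrite rpredD ?uU ?IH // ltnW.
      rewrite /u (_ : i + j%:Z + k%:Z - 1 = i + k%:Z - 1 + j%:Z); last by lia.
      by rewrite (addrC (v _)) subrK; congr v; lia.
    have uiU : u i \in U by rewrite -[i]addr0 uU.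
    rewrite addr0 (_ : v _ = v (i + k%:Z) - u i); last first.
      by rewrite /u opprB (addrC (v _)) subrK.
    rewrite rpredB //.
    rewrite (_ : v _ = (s (i + k%:Z - 1 - 1))^-1 *:
       (u (i + k%:Z - 1) + p.2 (i + k%:Z - 1 - 1) *: u i)); last first.
      by rewrite uE scalerA mulVf ?scale1r.
    rewrite memvZ // rpredD ?memvZ //.
    by rewrite (_ : i + k%:Z - 1 = i + k.-1%:Z); [apply: uU; lia|lia].
  apply/subv_sumP => j _; have [_ ->] := lv (i + k%:Z - 1 + j%:Z).
  by rewrite -memvE vU.
- rewrite -!/(s _) addrK.
  (* Substituting for [v (i + k)] from [vk] leaves a relation among values of [u] only. *)
  have uk : u (i + k%:Z) = p.1 (i + k%:Z) *: u (i + 1) +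
      s (i + k%:Z - 1) *: v (i + k%:Z).
    rewrite /u (rv (i + k%:Z)) addrK (addrAC i 1) addrK /s subrK.
    coordinatewise; ring.
  have vk : v (i + k%:Z) = (s (i + k%:Z - 1 - 1))^-1 *:
       (u (i + k%:Z - 1) + p.2 (i + k%:Z - 1 - 1) *: u i).
    by rewrite uE scalerA mulVf ?scale1r.
  rewrite uk vk !scalerDr !scalerA.
  rewrite (_ : i - 1 + k%:Z - 1 = i + k%:Z - 1 - 1); last by lia.
  by coordinatewise; field; rewrite !s0.
- rewrite /s !(addrAC _ n%:Z).
  by rewrite !(proj1 (pp _)) !(proj2 (pp _)).
- by rewrite !mulf_neq0 ?invr_eq0 ?s0.
- by rewrite !mulf_neq0 ?invr_eq0 ?s0.
Qed.

End PentagramMaps.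

(** * Projective duality and the coordinate map D *)

Section Duality.
Context {R : realType} {E : vectType R}.
Implicit Types (V : int -> {vspace E}) (v : int -> E) (p : xy R).
Implicit Types (phi : int -> 'Hom(E, R^o)).

Lemma D_shift k p : (2 < k)%N -> D_ k (shift (r'_ k) p) =
  (fun i : int => (p.1 (i + k%:Z - 2))^-1 *
     \prod_(j < k - 2) (p.2 (i + j%:Z) / p.1 (i + j%:Z)),
   fun i : int => (p.1 (i + k%:Z - 1))^-1 *
     \prod_(j < k - 1) (p.2 (i + j%:Z) / p.1 (i + j%:Z))).
Proof.
move=> k3; have rE := r_r' k3; rewrite /D_ /shift /=.
congr pair; apply/funext => i; congr (_ * _).
- by congr (p.1 _)^-1; lia.
- by apply: eq_bigr => j _; congr (p.2 _ / p.1 _); lia.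
- by congr (p.1 _)^-1; lia.
- by apply: eq_bigr => j _; congr (p.2 _ / p.1 _); lia.
Qed.

Lemma dim_dual : \dim {:'Hom(E, R^o)} = \dim {:E}.
Proof. by rewrite !dimvf /dim /= muln1. Qed.

Lemma eq_lfun_window k v i (f g : 'Hom(E, R^o)) : \dim {:E} = k ->
  free (window k v i) ->
  (forall j, (j < k)%N -> f (v (i + j%:Z)) = g (v (i + j%:Z))) -> f = g.
Proof.
move=> dE fr fg; apply/lfunP => u.
have uw : u \in <<window k v i>>%VS.
  have /andP[/eqP -> _] : basis_of fullv (window k v i); last exact: memvf.
  by rewrite basisEfree fr subvf dE size_tuple leqnn.
rewrite (coord_span uw) !linear_sum; apply: eq_bigr => j _.
by rewrite !linearZ /= nth_window ?fg.
Qed.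

(* phi i is the equation of the hyperplane Delta_ k V i, normalised at
   v (i + k - 1). *)
Definition dual_lift k v phi : Prop := forall i (j : nat), (j < k)%N ->
  phi i (v (i + j%:Z)) = (j == k.-1)%:R.

(** The form is the last coordinate function of the window. *)
Lemma dual_lift_ex k v : (0 < k)%N -> (forall i, free (window k v i)) ->
  exists phi, dual_lift k v phi.
Proof.
case: k => // k _ fr.
have lin i : linear (coord (window k.+1 v i) ord_max : E -> R^o).
  by move=> a u u'; rewrite linearP.
exists (fun i => linfun (HB.pack_for {linear E -> R^o}
  (coord (window k.+1 v i) ord_max : E -> R^o)
  (GRing.isLinear.Build _ _ _ _ _ (lin i)))) => i j jk.
by rewrite lfunE /= -(nth_window v i jk) (coord_free (Ordinal jk)).
Qed.

(** While the first two vectors on the right of the recurrence lie in the hyperplane, only the last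
    term counts, and the value 1 propagates. *)
Lemma dual_lift_one k v p phi i (j : nat) : (j.+1 < k)%N ->
  recurrence k v p -> dual_lift k v phi -> phi i (v (i + k%:Z - 1 + j%:Z)) = 1.
Proof.
move=> jk rv d; elim: j jk => [|j IH] jk.
  rewrite addr0 (_ : i + k%:Z - 1 = i + k.-1%:Z); last by lia.
  by rewrite d ?eqxx //; lia.
rewrite (_ : _ + j.+1%:Z = i + j%:Z + k%:Z); last by lia.
rewrite rv (_ : i + j%:Z + 1 = i + j.+1%:Z); last by lia.
rewrite (_ : i + j%:Z + k%:Z - 1 = i + k%:Z - 1 + j%:Z); last by lia.
rewrite !linearD !linearZ /= IH ?(ltnW jk) // !d; try by lia.
rewrite (_ : (j == k.-1) = false); last by lia.
rewrite (_ : (j.+1 == k.-1) = false); last by lia.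
by rewrite !scaler0 !add0r.
Qed.

Lemma dual_recurrence k v p phi i : (2 < k)%N -> \dim {:E} = k ->
  (forall i, free (window k v i)) -> recurrence k v p -> dual_lift k v phi ->
  p.2 (i + k%:Z - 2) *: phi (i + k%:Z) =
  phi i - phi (i + 1) - p.1 (i + k%:Z - 2) *: phi (i + k%:Z - 1).
Proof.
move=> k3 dE fr rv d.
apply: (eq_lfun_window dE (fr (i + k%:Z - 1))) => j jk.
rewrite !(add_lfunE, opp_lfunE, scale_lfunE) d //.
case: j jk => [|j] jk.
  rewrite (dual_lift_one i _ rv d) ?addr0; last by lia.
  rewrite (_ : i + k%:Z - 1 = i + 1 + k.-2%:Z); last by lia.
  rewrite d; last by lia.
  rewrite (_ : (k.-2 == k.-1) = false); last by lia.
  rewrite (_ : (0%N == k.-1) = false); last by lia.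
  rewrite !scaler0 !subr0.
  (* [v (i + k - 1)] lies just before the window of [phi (i + k)]; this instance of the recurrence
     gives y_(i+k-2) times its value as 1. *)
  have := congr1 (phi (i + k%:Z)) (rv (i + k%:Z - 1)).
  rewrite !linearD !linearZ /=.
  rewrite (_ : i + k%:Z - 1 + k%:Z - 1 = i + k%:Z + k.-2%:Z); last by lia.
  rewrite (_ : i + k%:Z - 1 + k%:Z = i + k%:Z + k.-1%:Z); last by lia.
  rewrite (_ : i + k%:Z - 1 + 1 = i + k%:Z + 0%:Z); last by lia.
  rewrite (_ : i + k%:Z - 1 - 1 = i + k%:Z - 2); last by lia.
  rewrite (_ : i + k%:Z - 1 = i + 1 + k.-2%:Z); last by lia.
  rewrite !d; try by lia.
  rewrite eqxx (_ : (k.-2 == k.-1) = false); last by lia.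
  rewrite (_ : (0%N == k.-1) = false); last by lia.
  by rewrite scaler0 !addr0.
rewrite (_ : phi (i + k%:Z) _ = 0); last first.
  rewrite (_ : _ + j.+1%:Z = i + k%:Z + j%:Z); last by lia.
  rewrite d; last by lia.
  by rewrite (_ : (j == k.-1) = false) //; lia.
rewrite (_ : phi (i + 1) _ = 1); last first.
  rewrite (_ : _ + j.+1%:Z = i + 1 + k%:Z - 1 + j%:Z); last by lia.
  exact: dual_lift_one rv d.
rewrite scaler0.
(* At interior points [phi i] and [phi (i + 1)] are both 1 and cancel. At the last point [phi i] is
   x_(i+k-2) + 1, and the x-term cancels the excess. *)
have [jk1|jk1] := eqVneq j.+1 k.-1; last first.
  rewrite (dual_lift_one i _ rv d); last by lia.
  by rewrite subrr scaler0 subr0.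
rewrite (_ : i + k%:Z - 1 + j.+1%:Z = i + k.-2%:Z + k%:Z); last by lia.
rewrite rv !linearD !linearZ /= d; last by lia.
rewrite (_ : (k.-2 == k.-1) = false); last by lia.
rewrite (_ : i + k.-2%:Z + 1 = i + k.-1%:Z); last by lia.
rewrite (_ : i + k.-2%:Z + k%:Z - 1 = i + k%:Z - 1 + k.-2%:Z); last by lia.
rewrite (dual_lift_one i _ rv d); last by lia.
rewrite d; last by lia.
rewrite eqxx scaler0 add0r addrK.
rewrite (_ : i + k.-2%:Z = i + k%:Z - 2); last by lia.
by rewrite scalerN subrr.
Qed.

Lemma Delta_lift k V v phi : (0 < k)%N -> \dim {:E} = k -> lift_of V v ->
  (forall i, free (window k v i)) -> dual_lift k v phi ->
  lift_of (Delta_ k V) phi.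
Proof.
move=> k0 dE lv fr d i; split.
  apply/eqP => phi0; have := d i k.-1; rewrite phi0 zero_lfunE eqxx => e.
  have /esym/eqP : (0 : R^o) = 1 by apply: e; rewrite prednK.
  by rewrite oner_eq0.
have phi_ann : phi i \in Delta_ k V i.
  apply/annihilatorP => u /memv_sumP[w wV ->].
  rewrite linear_sum big1 // => j _; have := wV j isT.
  rewrite (proj2 (lv _)) => /vlineP[c ->]; have jk := ltn_ord j.
  rewrite linearZ /= d; last by lia.
  rewrite (_ : (nat_of_ord j == k.-1) = false); last by lia.
  exact: scaler0.
apply/eqP; rewrite eqEsubv -memvE phi_ann andbT.
apply/subvP => f /annihilatorP f0; apply/vlineP.
(* A form vanishing on the hyperplane is determined by its value at the one remaining vertex of the
   window. *)
exists (f (v (i + k.-1%:Z))).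
apply: (eq_lfun_window dE (fr i)) => j jk; rewrite scale_lfunE d //.
have [->|jk1] := eqVneq j k.-1; first by rewrite /GRing.scale /= mulr1.
rewrite scaler0; apply: f0.
have jk' : (j < k.-1)%N by lia.
apply: (subvP (@sumv_sup _ _ _ (Ordinal jk') _ _ _ _ (subvv _))) => //=.
by rewrite (proj2 (lv _)) memv_line.
Qed.

(** The forms phi_(i+m) evaluated at the vectors v_(i+k-1+l) give a triangular matrix, zero for m >
    l and 1 for m = l; strong induction on l kills the coefficients of a dependency. *)
Lemma Delta_generic k V v phi : (0 < k)%N -> \dim {:E} = k -> lift_of V v ->
  (forall i, free (window k v i)) -> dual_lift k v phi ->
  generic k (Delta_ k V).
Proof.
move=> k0 dE lv fr d.
have dH : \dim {:'Hom(E, R^o)} = k by rewrite dim_dual.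
apply/(generic_window dH (Delta_lift k0 dE lv fr d)) => i.
apply/freeP => c c0 [l lk].
elim/ltn_ind: l lk => l IH lk.
have := congr1 (fun f : 'Hom(E, R^o) => f (v (i + k.-1%:Z + l%:Z))) c0.
rewrite zero_lfunE sum_lfunE (bigD1 (Ordinal lk)) //= big1 => [|[m mk] ml].
  rewrite addr0 scale_lfunE nth_window //=.
  rewrite (_ : i + k.-1%:Z + l%:Z = i + l%:Z + k.-1%:Z); last by lia.
  rewrite d; last by lia.
  by rewrite eqxx /GRing.scale /= mulr1.
rewrite scale_lfunE nth_window //=.
have [ltml|lem] := ltnP m l; first by rewrite IH ?scale0r.
have {}ml : m != l by move: ml; rewrite -val_eqE.
rewrite (_ : _ + l%:Z = i + m%:Z + (k.-1 + l - m)%N%:Z); last by lia.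
rewrite d; last by lia.
rewrite (_ : (_ == _) = false); last by lia.
exact: scaler0.
Qed.

Lemma Delta_coords k n V : (2 < k)%N -> \dim {:E} = k -> in_P0 k n V ->
  in_P0 k n (Delta_ k V) /\
  coords k n (Delta_ k V) =
    scale ((-1) ^+ k) (D_ k (shift (r'_ k) (coords k n V))).
Proof.
move=> k3 dE inP.
have [v [lv rv x0 y0]] := P0_coords_elim inP.
have [pp _] := coordsP inP; have [_ gV _ _] := inP.
move: rv x0 y0 pp; set p := coords k n V; clearbody p => rv x0 y0 pp.
have /(generic_window dE lv) fr := gV.
have k0 : (0 < k)%N by lia.
have [phi d] := dual_lift_ex k0 fr.
have lphi := Delta_lift k0 dE lv fr d.
have gphi := Delta_generic k0 dE lv fr d.
have rphi i := dual_recurrence i k3 dE fr rv d.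
pose q i := p.2 i / p.1 i.
have q0 i : q i != 0 by rewrite mulf_neq0 ?invr_eq0.
have [|l lP] := @rescaling R (fun i => - q (i - 1)).
  by move=> i; rewrite oppr_eq0.
have l0 i : l i != 0 by case: (lP i).
have lprod i m : l (i + m%:Z) =
    l i * ((-1) ^+ m * \prod_(j < m) q (i - 1 + j%:Z)).
  elim: m => [|m IH]; first by rewrite big_ord0 addr0 !mulr1.
  rewrite (_ : i + m.+1%:Z = i + m%:Z + 1); last by lia.
  rewrite (proj2 (lP _)) IH big_ord_recr /= exprS (addrAC i (-1)).
  by ring.
have lpsi := lift_of_scale lphi l0.
have dH : \dim {:'Hom(E, R^o)} = k by rewrite dim_dual.
rewrite D_shift //.
apply: (P0_coords_intro k3 dH lpsi gphi) => [i|i|i|i] /=.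
(* [X1] and [Y1] match the coefficients of the rescaled forms at [i + 1] and [i], at distances k - 1
   and k from [i + k]. The last factor of [lprod], divided by y_(i+k-2), becomes 1 / x_(i+k-2); in
   [X1] the minus sign before [phi (i + 1)] completes (-1)^k. *)
- have X1 : (-1) ^+ k * ((p.1 (i + k%:Z - 2))^-1 *
      \prod_(j < k - 2) q (i + j%:Z)) =
      - (l (i + k%:Z) / (l (i + 1) * p.2 (i + k%:Z - 2))).
    rewrite (_ : i + k%:Z = i + 1 + (k - 2).+1%:Z); last by lia.
    rewrite lprod addrK big_ord_recr /=.
    rewrite (_ : i + 1 + (k - 2).+1%:Z - 2 = i + (k - 2)%N%:Z); last by lia.
    rewrite (_ : (-1) ^+ k = (-1) ^+ (k - 2).+2); last by congr (_ ^+ _); lia.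
    rewrite [q (i + (k - 2)%N%:Z)]/q !exprS.
    by field; rewrite l0 x0 y0.
  have Y1 : (-1) ^+ k * ((p.1 (i - 1 + k%:Z - 1))^-1 *
      \prod_(j < k - 1) q (i - 1 + j%:Z)) =
      l (i + k%:Z) / (l i * p.2 (i + k%:Z - 2)).
    rewrite (_ : i - 1 + k%:Z - 1 = i + k%:Z - 2); last by lia.
    rewrite (_ : i + k%:Z = i + (k - 1).+1%:Z); last by lia.
    rewrite lprod big_ord_recr /=.
    rewrite (_ : i + (k - 1).+1%:Z - 2 = i - 1 + (k - 1)%N%:Z); last by lia.
    rewrite (_ : (-1) ^+ k = (-1) ^+ (k - 1).+1); last by congr (_ ^+ _); lia.
    rewrite [q (i - 1 + (k - 1)%N%:Z)]/q !exprS.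
    by field; rewrite l0 x0 y0.
  rewrite -!/(q _) in X1 Y1 *.
  rewrite X1 Y1.
  have -> : phi (i + k%:Z) = (p.2 (i + k%:Z - 2))^-1 *: (phi i - phi (i + 1)
      - p.1 (i + k%:Z - 2) *: phi (i + k%:Z - 1)).
    by rewrite -rphi scalerA mulVf ?scale1r.
  have lk : l (i + k%:Z) =
      - (l (i + k%:Z - 1) * (p.2 (i + k%:Z - 2) / p.1 (i + k%:Z - 2))).
    have [_] := lP (i + k%:Z - 1); rewrite subrK mulrN => ->.
    by rewrite (_ : i + k%:Z - 1 - 1 = i + k%:Z - 2) //; lia.
  rewrite lk.
  by coordinatewise; field; rewrite !l0 x0 y0.
- split; congr (_ * (_ * _)).
  + by rewrite -(proj1 (pp (i + k%:Z - 2))); congr (p.1 _)^-1; lia.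
  + by apply: eq_bigr => j _; rewrite (addrAC i) (proj1 (pp _)) (proj2 (pp _)).
  + by rewrite -(proj1 (pp (i + k%:Z - 1))); congr (p.1 _)^-1; lia.
  + by apply: eq_bigr => j _; rewrite (addrAC i) (proj1 (pp _)) (proj2 (pp _)).
- rewrite !mulf_neq0 ?signr_eq0 ?invr_eq0 //.
  by apply/prodf_neq0 => j _; exact: q0.
- rewrite !mulf_neq0 ?signr_eq0 ?invr_eq0 //.
  by apply/prodf_neq0 => j _; exact: q0.
Qed.

End Duality.

Theorem theorem5p6 (R : realType) (k n : nat) (k_ge3 : (3 <= k)%N)
    (k_len : (k <= n)%N) :
  (* (i) *)
  (forall V : int -> {vspace 'rV[R]_k}, in_P0 k n V ->
    [/\ in_P0 k n (F_ k V) <-> T_dom n (shift (r'_ k + 1) (coords k n V)),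
        in_P0 k n (F_ k V) ->
          coords k n (F_ k V) = T_ k (shift (r'_ k + 1) (coords k n V)),
        in_P0 k n (G_ k V) <->
          (T_ k @` T_dom n)%classic (shift (r_ k + 1) (coords k n V))
      & in_P0 k n (G_ k V) ->
          coords k n (G_ k V) = Tinv_ k n (shift (r_ k + 1) (coords k n V))])
  /\
  (* (ii) *)
  (forall V : int -> {vspace 'rV[R]_k}, in_P0 k n V ->
    [/\ D_dom n (shift (r'_ k) (coords k n V)),
        in_P0 k n (Delta_ k V)
      & coords k n (Delta_ k V) =
          scale ((-1) ^+ k) (D_ k (shift (r'_ k) (coords k n V)))]).
Proof.
have dE : \dim {:'rV[R]_k} = k by rewrite dimvf /dim /= mul1n.
split=> V inP; have [pp _] := coordsP inP.
  split.
  - split=> [Fin|[_ z0]].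
      split=> i; last exact: F_dom inP Fin _.
      by rewrite /shift /= !(addrAC i n%:Z); exact: pp.
    have [] // := F_coords k_ge3 dE inP => i.
    by have := z0 (i - (r'_ k + 1)%N%:Z); rewrite /shift /= subrK.
  - by move=> Fin; have [] := F_coords k_ge3 dE inP (F_dom inP Fin).
  - split=> [Gin|/(T_image k_ge3 pp) s0].
      by apply/(T_image k_ge3 pp); exact: G_dom inP Gin.
    by have [] := G_coords k_ge3 dE inP s0.
  - by move=> Gin; have [] := G_coords k_ge3 dE inP (G_dom inP Gin).
have [Din ->] := Delta_coords k_ge3 dE inP.
(* Membership in [D_dom] is automatic, since every x_i is nonzero on P^0. *)
have [_ [_ _ x0 _]] := P0_coords_elim inP.
split=> //; split=> i; last exact: x0.
by rewrite /shift /= !(addrAC i n%:Z); exact: pp.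
Qed.
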